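(* Let $\mathbf{y}\in\mathbb{C}^N$ and $\mathbf{B}\in\mathbb{C}^{N\times M}$, where every column of $\mathbf{B}$ is nonzero, and use the notation $\mathbf{R}(\mathbf{p})$, $w_k$, $\mathbf{\Pi}(\mathbf{p})$, $\mathbf{b}_k^*$, $J$, $F$, $L$ defined in the context. Then: (a) For every fixed $\mathbf{x}\in\mathbb{C}^M$, the minimum of $F(\mathbf{x},\mathbf{p})$ over $\mathbf{p}\in[0,\infty)^{M+N}$ is attained at $$p_k=\frac{|x_k|}{\sqrt{w_k}},\quad k=1,\dots,M,\qquad p_{M+k}=\frac{|y_k-\mathbf{b}_k^*\mathbf{x}|}{\sqrt{w_{M+k}}},\quad k=1,\dots,N,$$ and the minimum value equals $2L(\mathbf{x})$, i.e. twice the weighted $\ell_1$-penalized least-absolute-deviation criterion. (b) If $\hat{\mathbf{p}}$ minimizes the SPICE criterion $J(\mathbf{p})$ over $\mathcal{D}=\{\mathbf{p}\in[0,\infty)^{M+N}:\mathbf{R}(\mathbf{p})\text{ is invertible}\}$ and $\hat{\mathbf{x}}=\mathbf{\Pi}(\hat{\mathbf{p}})\mathbf{B}^*\mathbf{R}(\hat{\mathbf{p}})^{-1}\mathbf{y}$, then $(\hat{\mathbf{x}},\hat{\mathbf{p}})$ minimizes $F$ over $\mathbb{C}^M\times[0,\infty)^{M+N}$ and $\hat{\mathbf{x}}$ minimizes $L$ over $\mathbb{C}^M$. (c) Conversely, if $(\tilde{\mathbf{x}},\tilde{\mathbf{p}})$ minimizes $F$ over $\mathbb{C}^M\times[0,\infty)^{M+N}$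 and $\mathbf{R}(\tilde{\mathbf{p}})$ is invertible, then $\tilde{\mathbf{p}}$ minimizes $J$ over $\mathcal{D}$.
   Context: Let $\mathbf{A}=[\mathbf{B}\;\;\mathbf{I}_N]=[\mathbf{a}_1\,\cdots\,\mathbf{a}_{M+N}]\in\mathbb{C}^{N\times(M+N)}$, where $\mathbf{a}_k$ is the $k$th column of $\mathbf{A}$, and let $w_k=\|\mathbf{a}_k\|_2^2$ for $k=1,\dots,M+N$. The $k$th row of $\mathbf{B}$ is denoted $\mathbf{b}_k^*$, and $(\cdot)^*$ denotes Hermitian transpose. For $\mathbf{p}=(p_1,\dots,p_{M+N})\in[0,\infty)^{M+N}$ set $$\mathbf{R}(\mathbf{p})=\mathbf{A}\,\mathrm{diag}(p_1,\dots,p_{M+N})\,\mathbf{A}^*,\qquad \mathbf{\Pi}(\mathbf{p})=\mathrm{diag}(p_1,\dots,p_M).$$ The SPICE criterion is $$J(\mathbf{p})=\mathbf{y}^*\mathbf{R}(\mathbf{p})^{-1}\mathbf{y}+\sum_{k=1}^{M+N}w_kp_k .$$ The augmented criterion is $$F(\mathbf{x},\mathbf{p})=\sum_{k=1}^{N}\frac{|y_k-\mathbf{b}_k^*\mathbf{x}|^2}{p_{M+k}}+\sum_{k=1}^{M}\frac{|x_k|^2}{p_k}+\sum_{k=1}^{M+N}w_kp_k,$$ with the conventions $0/0=0$ and $a/0=+\infty$ for $a>0$. The weighted $\ell_1$-penalized LAD criterion is $$L(\mathbf{x})=\|\mathbf{W}_1^{1/2}(\mathbf{y}-\mathbf{B}\mathbf{x})\|_1+\|\mathbf{W}_2^{1/2}\mathbf{x}\|_1,$$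 where $\mathbf{W}_1=\mathrm{diag}(w_{M+1},\dots,w_{M+N})$, $\mathbf{W}_2=\mathrm{diag}(w_1,\dots,w_M)$, and $\|\mathbf{v}\|_1=\sum_i|v_i|$ (complex moduli). *)

(* Defs.v *)
From HB Require Import structures.
From mathcomp Require Import all_boot all_order all_algebra.
From mathcomp Require Import complex.
From mathcomp Require Import boolp classical_sets reals constructive_ereal.

Set Implicit Arguments.
Unset Strict Implicit.
Unset Printing Implicit Defensive.

Import Order.TTheory GRing.Theory Num.Theory.

Local Open Scope classical_set_scope.
Local Open Scope ring_scope.

(* The complex numbers are R[i] for a realType R, and the modulus is the
   R-valued Normc.normc, so that all criteria take values in R or \bar R.
   Columns 1..M of A are the indices lshift N k and columns M+1..M+N the
   indices rshift M k, for 'I_(M + N). *)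

Definition minimizes (T : Type) (d : Order.disp_t) (V : porderType d)
    (f : T -> V) (D : set T) (t : T) : Prop :=
  D t /\ forall u, D u -> (f t <= f u)%O.

Definition ctrmx (R : realType) (m n : nat) (X : 'M[R[i]]_(m, n)) :
    'M[R[i]]_(n, m) :=
  map_mx Num.conj X^T.

Definition cdiag (R : realType) (n : nat) (d : 'rV[R]_n) : 'M[R[i]]_n :=
  diag_mx (map_mx (real_complex R) d).

Definition l1norm (R : realType) (n : nat) (v : 'cV[R[i]]_n) : R :=
  \sum_(i < n) Normc.normc (v i 0).

Definition nonneg_vec (R : realType) (n : nat) : set 'rV[R]_n :=
  [set p | forall k, 0 <= p 0 k].
Arguments nonneg_vec {R n}.

Section Spice.
Variables (R : realType) (N M : nat).
Variables (y : 'cV[R[i]]_N) (B : 'M[R[i]]_(N, M)).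

Definition Amx : 'M[R[i]]_(N, M + N) := row_mx B 1%:M.

Definition weight (k : 'I_(M + N)) : R :=
  \sum_(i < N) Normc.normc (Amx i k) ^+ 2.

Definition Rmx (p : 'rV[R]_(M + N)) : 'M[R[i]]_N :=
  Amx *m cdiag p *m ctrmx Amx.

Definition Pimx (p : 'rV[R]_(M + N)) : 'M[R[i]]_M := cdiag (lsubmx p).

Definition spice_dom : set 'rV[R]_(M + N) :=
  [set p | nonneg_vec p /\ Rmx p \in unitmx].

(* y^* R(p)^-1 y is a real number (quad_form_real below), so taking its real
   part only changes its type. *)
Definition quad_form (p : 'rV[R]_(M + N)) : R[i] :=
  (ctrmx y *m invmx (Rmx p) *m y) 0 0.

Definition Jcrit (p : 'rV[R]_(M + N)) : R :=
  complex.Re (quad_form p) + \sum_(k < M + N) weight k * p 0 k.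

(* y_k - b_k^* x, where b_k^* is the k-th row of B *)
Definition resid (x : 'cV[R[i]]_M) (k : 'I_N) : R[i] :=
  y k 0 - (row k B *m x) 0 0.

(* Division in \bar R satisfies 0%:E^-1 = +oo and 0 * +oo = 0; hence
   0 / 0 = 0 and a / 0 = +oo for a > 0. *)
Definition Fcrit (x : 'cV[R[i]]_M) (p : 'rV[R]_(M + N)) : \bar R :=
  (\sum_(k < N)
      ((Normc.normc (resid x k) ^+ 2)%R%:E / (p 0%R (rshift M k))%:E)
   + \sum_(k < M)
      ((Normc.normc (x k 0%R) ^+ 2)%R%:E / (p 0%R (lshift N k))%:E)
   + (\sum_(k < M + N) weight k * p 0 k)%R%:E)%E.

Definition W1sqrt : 'M[R[i]]_N :=
  cdiag (\row_(k < N) Num.sqrt (weight (rshift M k))).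

Definition W2sqrt : 'M[R[i]]_M :=
  cdiag (\row_(k < M) Num.sqrt (weight (lshift N k))).

Definition Lcrit (x : 'cV[R[i]]_M) : R :=
  l1norm (W1sqrt *m (y - B *m x)) + l1norm (W2sqrt *m x).

Definition xhat (p : 'rV[R]_(M + N)) : 'cV[R[i]]_M :=
  Pimx p *m ctrmx B *m invmx (Rmx p) *m y.

Lemma ctrmxM (m n q : nat) (X : 'M[R[i]]_(m, n)) (Y : 'M[R[i]]_(n, q)) :
  ctrmx (X *m Y) = ctrmx Y *m ctrmx X.
Proof. by rewrite /ctrmx trmx_mul map_mxM. Qed.

Lemma ctrmxK (m n : nat) (X : 'M[R[i]]_(m, n)) : ctrmx (ctrmx X) = X.
Proof. by apply/matrixP => i j; rewrite !mxE conjCK. Qed.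

Lemma ctrmx_inv (n : nat) (X : 'M[R[i]]_n) :
  ctrmx (invmx X) = invmx (ctrmx X).
Proof. by rewrite /ctrmx trmx_inv map_invmx. Qed.

Lemma ctrmx_cdiag (n : nat) (d : 'rV[R]_n) : ctrmx (cdiag d) = cdiag d.
Proof.
rewrite /ctrmx /cdiag tr_diag_mx; apply/matrixP => i j.
rewrite !mxE rmorphMn; congr (_ *+ _).
by rewrite -[LHS]/(_ +i* (- 0))%C oppr0.
Qed.

Lemma quad_form_real (p : 'rV[R]_(M + N)) :
  (complex.Re (quad_form p))%:C%C = quad_form p.
Proof.
have RH : ctrmx (Rmx p) = Rmx p.
  by rewrite /Rmx !ctrmxM ctrmxK ctrmx_cdiag mulmxA.
apply: RRe_real; apply/CrealP.
have -> : Num.conj (quad_form p)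
        = ctrmx (ctrmx y *m invmx (Rmx p) *m y) 0 0.
  by rewrite [in RHS]/ctrmx [RHS]mxE [in RHS]mxE.
rewrite !ctrmxM ctrmxK ctrmx_inv RH.
by rewrite mulmxA.
Qed.

End Spice.

(* Main.v *)
(* With c = A^* R(p)^-1 y, completing the square termwise in
   |u_k|^2 / p_k >= 2 Re(conj(c_k) u_k) - p_k |c_k|^2 for A u = y gives
   F(x, p) >= J(p), with equality at u = diag(p) c, that is at x = xhat(p); the
   same inequality with slope sqrt(w_k) gives F(x, p) >= 2 L(x).  Powers p with
   R(p) singular are reached from p + e, e > 0: there R is invertible and F
   exceeds F(x, p) by at most e times the sum of the weights. *)
Require Import Defs.
From mathcomp Require Import all_boot all_order all_algebra.
From mathcomp Require Import complex.
From mathcomp Require Import boolp classical_sets reals constructive_ereal.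
From mathcomp Require Import ring lra.
Import Order.TTheory GRing.Theory Num.Theory.
Local Open Scope classical_set_scope.
Local Open Scope ring_scope.

(** * Real parts and moduli of complex numbers *)

Section ComplexModulus.
Set Implicit Arguments.
Unset Strict Implicit.
Variable R : realType.
Implicit Types (r : R) (c u : R[i]).
Local Notation normc := (@Normc.normc R).

Lemma Re_sum (I : finType) (f : I -> R[i]) :
  complex.Re (\sum_i f i) = \sum_i complex.Re (f i).
Proof. by rewrite (big_morph (@complex.Re R) (id1 := 0) (op1 := +%R)) // => -[? ?] []. Qed.

Lemma Re_realM r c : complex.Re (r%:C%C * c) = r * complex.Re c.
Proof. by case: c => a b /=; rewrite mul0r subr0. Qed.

Lemma normc_ge0 c : 0 <= normc c.
Proof. by case: c => a b; apply: sqrtr_ge0. Qed.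

Lemma normc_real r : 0 <= r -> normc r%:C%C = r.
Proof. by move=> r0 /=; rewrite expr0n addr0 sqrtr_sqr ger0_norm. Qed.

Lemma normc_conj c : normc (Num.conj c) = normc c.
Proof. by case: c => a b /=; rewrite sqrrN. Qed.

Lemma Re_le_normc c : complex.Re c <= normc c.
Proof.
case: c => a b /=; apply: le_trans (ler_norm a) _.
by rewrite -sqrtr_sqr ler_wsqrtr // lerDl sqr_ge0.
Qed.

Lemma Re_conjM_le c u : complex.Re (Num.conj c * u) <= normc c * normc u.
Proof. by rewrite -(normc_conj c) -Normc.normcM Re_le_normc. Qed.

Lemma Re_conjM_self c : complex.Re (Num.conj c * c) = normc c ^+ 2.
Proof.
case: c => a b /=; rewrite sqr_sqrtr ?addr_ge0 ?sqr_ge0 //.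
by rewrite mulNr opprK -!expr2.
Qed.

End ComplexModulus.

(** * The function a^2 / p with extended real values *)

Section QuadOverLin.
Set Implicit Arguments.
Unset Strict Implicit.
Variable R : realType.
Implicit Types (a p q t : R).

(* Supporting line of a^2 / p at slope t; p = 0 relies on the conventions
   0 / 0 = 0 and a / 0 = +oo of \bar R. *)
Lemma quad_over_lin_ge a p t : 0 <= p ->
  ((2 * a * t - p * t ^+ 2)%:E <= (a ^+ 2)%:E / p%:E)%E.
Proof.
rewrite le_eqVlt => /predU1P[<-|p0].
  rewrite inve0 mul0r subr0; have [->|a0] := eqVneq a 0.
    by rewrite mulr0 mul0r expr0n mul0e.
  by rewrite gt0_muley ?leey // lte_fin exprn_even_gt0.
rewrite inver gt_eqF // -EFinM lee_fin -subr_ge0.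
have -> : a ^+ 2 / p - (2 * a * t - p * t ^+ 2) = (a - p * t) ^+ 2 / p.
  by field; rewrite gt_eqF.
by rewrite divr_ge0 ?sqr_ge0 // ltW.
Qed.

(** Equality case [a = p * t] of the supporting line. At [p = 0] both sides vanish because 0 / 0 =
    0. *)
Lemma quad_over_lin_eq p t :
  (((p * t) ^+ 2)%:E / p%:E = (p * t ^+ 2)%:E)%E.
Proof.
have [->|p0] := eqVneq p 0; first by rewrite !mul0r expr0n mul0e.
by rewrite inver (negPf p0) -EFinM; congr (_%:E); field.
Qed.

Lemma quad_over_lin_le a p q : 0 <= p -> p <= q ->
  ((a ^+ 2)%:E / q%:E <= (a ^+ 2)%:E / p%:E)%E.
Proof.
rewrite le_eqVlt => /predU1P[<-|p0] pq.
  rewrite inve0; have [->|a0] := eqVneq a 0; first by rewrite expr0n !mul0e.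
  by rewrite gt0_muley ?leey // lte_fin exprn_even_gt0.
have q0 := lt_le_trans p0 pq.
rewrite !inver !gt_eqF // -!EFinM lee_fin ler_wpM2l ?sqr_ge0 //.
by rewrite lef_pV2.
Qed.

End QuadOverLin.

(** * The criteria F and L as sums over the columns of A *)

Section Spice.
Set Implicit Arguments.
Unset Strict Implicit.
Variables (R : realType) (N M : nat).
Variables (y : 'cV[R[i]]_N) (B : 'M[R[i]]_(N, M)).
Implicit Types (x : 'cV[R[i]]_M) (p : 'rV[R]_(M + N)).
Local Notation normc := (@Normc.normc R).
Local Notation w := (weight B).
Local Notation A := (Amx B).

(* The coefficients u with A u = y are exactly those of the form augment x. *)
Definition augment x : 'cV[R[i]]_(M + N) := col_mx x (y - B *m x).

Lemma mul_Amx_augment x : A *m augment x = y.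
Proof. by rewrite /Amx /augment mul_row_col mul1mx addrC subrK. Qed.

Lemma augment_usubmx u : A *m u = y -> augment (usubmx u) = u.
Proof.
move=> Au; rewrite /augment -[RHS]vsubmxK; congr col_mx.
by rewrite -Au -{1}[u]vsubmxK /Amx mul_row_col mul1mx addrC addKr.
Qed.

Lemma cdiag_mulE n (d : 'rV[R]_n) (u : 'cV[R[i]]_n) k :
  (cdiag d *m u) k 0 = (d 0 k)%:C%C * u k 0.
Proof. by rewrite mul_diag_mx !mxE. Qed.

Lemma weight_ge0 k : 0 <= w k.
Proof. by apply: sumr_ge0 => i _; apply: sqr_ge0. Qed.

Lemma weight_gt0 k : col k A != 0 -> 0 < w k.
Proof.
rewrite lt_def weight_ge0 andbT; apply: contraNneq.
move=> /eqP; rewrite psumr_eq0 => [/allP w0|i _]; last exact: sqr_ge0.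
apply/eqP/colP => i; rewrite !mxE; apply: Normc.eq0_normc.
by have := w0 i (mem_index_enum i); rewrite !mxE sqrf_eq0 => /eqP.
Qed.

Lemma col_Amx_neq0 : (forall k, col k B != 0) -> forall k, col k A != 0.
Proof.
move=> hB k; case: (splitP k) => j kj.
  have -> : k = lshift N j by apply: val_inj.
  by rewrite colKl.
have -> : k = rshift M j by apply: val_inj.
rewrite colKr; apply/eqP => /colP/(_ j)/eqP.
by rewrite !mxE eqxx oner_eq0.
Qed.

(** Stacking [x] over its residual merges the three sums into one, so bounds on F reduce to a single
    index [k]. *)
Lemma FcritE x p :
  Fcrit y B x p = (\sum_k ((normc (augment x k 0) ^+ 2)%:E / (p 0 k)%:E
                           + (w k * p 0 k)%:E))%E.
Proof.
rewrite /Fcrit big_split sumEFin /=; congr (_ + _)%E.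
rewrite big_split_ord addeC /=; congr (_ + _)%E; apply: eq_bigr => k _.
  by rewrite /augment col_mxEu.
by rewrite /augment col_mxEd /resid -row_mul !mxE.
Qed.

Lemma LcritE x :
  Lcrit y B x = \sum_k Num.sqrt (w k) * normc (augment x k 0).
Proof.
rewrite /Lcrit /l1norm big_split_ord addrC.
by congr (_ + _); apply: eq_bigr => k _;
  rewrite cdiag_mulE Normc.normcM normc_real mxE ?sqrtr_ge0 //
    /augment ?col_mxEu ?col_mxEd.
Qed.

(** At slope [Num.sqrt (w k)] the term [- p * t ^+ 2] of the supporting line cancels the penalty
    [w k * p 0 k]. *)
Lemma Fcrit_ge2L x p : nonneg_vec p -> ((2 * Lcrit y B x)%:E <= Fcrit y B x p)%E.
Proof.
move=> p0; rewrite FcritE LcritE mulr_sumr -sumEFin; apply: lee_sum => k _.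
apply: le_trans _ (leeD2r _ (quad_over_lin_ge _ (Num.sqrt (w k)) (p0 k))).
rewrite -EFinD lee_fin sqr_sqrtr ?weight_ge0 //; lra.
Qed.

(** Solves the equality case [a = p * t] for [p] at slope [Num.sqrt (w k)]. *)
Definition lad_powers x : 'rV[R]_(M + N) :=
  \row_k (normc (augment x k 0) / Num.sqrt (w k)).

Lemma lad_powers_ge0 x : nonneg_vec (lad_powers x).
Proof. by move=> k; rewrite mxE divr_ge0 ?normc_ge0 ?sqrtr_ge0. Qed.

Lemma Fcrit_lad_powers x : (forall k, 0 < w k) ->
  Fcrit y B x (lad_powers x) = (2 * Lcrit y B x)%:E.
Proof.
move=> w0; rewrite FcritE LcritE mulr_sumr -sumEFin; apply: eq_bigr => k _.
have s0 : Num.sqrt (w k) != 0 by rewrite gt_eqF // sqrtr_gt0.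
have -> : normc (augment x k 0) = lad_powers x 0 k * Num.sqrt (w k).
  by rewrite [lad_powers x 0 k]mxE divfK.
rewrite quad_over_lin_eq -EFinD; congr (_%:E).
by rewrite -{2}[w k]sqr_sqrtr ?weight_ge0 //; ring.
Qed.

(** * Hermitian structure and invertibility of R(p) *)

Lemma ctrmx_Rmx p : ctrmx (Rmx B p) = Rmx B p.
Proof. by rewrite /Rmx !ctrmxM ctrmxK ctrmx_cdiag mulmxA. Qed.

Lemma inner_ctrmxE n (c u : 'cV[R[i]]_n) :
  complex.Re ((ctrmx c *m u) 0 0) = \sum_k complex.Re (Num.conj (c k 0) * u k 0).
Proof.
by rewrite mxE Re_sum; apply: eq_bigr => k _; rewrite !mxE.
Qed.

Lemma Re_quad_cdiag n (d : 'rV[R]_n) (c : 'cV[R[i]]_n) :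
  complex.Re ((ctrmx c *m cdiag d *m c) 0 0) = \sum_k d 0 k * normc (c k 0) ^+ 2.
Proof.
rewrite -mulmxA inner_ctrmxE; apply: eq_bigr => k _.
by rewrite cdiag_mulE mulrCA Re_realM Re_conjM_self.
Qed.

(** If v R(p) = 0, then v R(p) v^* = sum_k p_k |(v A)_k|^2 vanishes, so v A = 0, and the identity
    block of A gives v = 0. *)
Lemma Rmx_unit_gt0 p : (forall k, 0 < p 0 k) -> Rmx B p \in unitmx.
Proof.
move=> p0; rewrite -row_free_unit; apply: inj_row_free => v vR.
have /eqP : complex.Re ((v *m Rmx B p *m ctrmx v) 0 0) = 0.
  by rewrite vR mul0mx mxE.
have -> : v *m Rmx B p *m ctrmx v
    = ctrmx (ctrmx (v *m A)) *m cdiag p *m ctrmx (v *m A).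
  by rewrite ctrmxK /Rmx ctrmxM !mulmxA.
rewrite Re_quad_cdiag psumr_eq0 => [/allP c0|k _]; last first.
  by rewrite mulr_ge0 ?sqr_ge0 // ltW.
have vA : v *m A = 0.
  rewrite -[v *m A]ctrmxK; apply/rowP => k.
  have := c0 k (mem_index_enum k).
  rewrite mulf_eq0 gt_eqF //= sqrf_eq0 => /eqP/Normc.eq0_normc ck.
  by rewrite mxE [_^T _ _]mxE ck rmorph0 mxE.
by move: vA; rewrite /Amx mul_mx_row mulmx1 -row_mx0 => /eq_row_mx[].
Qed.

(** * Comparison of J and F at powers with R(p) invertible *)

Section Dual.
Variable p : 'rV[R]_(M + N).
Hypothesis Runit : Rmx B p \in unitmx.

Definition dual : 'cV[R[i]]_(M + N) := ctrmx A *m invmx (Rmx B p) *m y.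

Lemma ctrmx_dual : ctrmx dual = ctrmx y *m invmx (Rmx B p) *m A.
Proof. by rewrite /dual !ctrmxM ctrmxK ctrmx_inv ctrmx_Rmx mulmxA. Qed.

Lemma mul_Amx_cdiag_dual : A *m (cdiag p *m dual) = y.
Proof. by rewrite /dual !mulmxA -/(Rmx B p) mulmxV // mul1mx. Qed.

(** The upper block of diag(p) c is [xhat] by definition; since A diag(p) c = y, the lower block
    must be the residual. *)
Lemma augment_xhat : augment (xhat y B p) = cdiag p *m dual.
Proof.
rewrite -[RHS](augment_usubmx mul_Amx_cdiag_dual); congr augment.
apply/colP => k; rewrite [RHS]mxE cdiag_mulE /xhat /Pimx -!mulmxA cdiag_mulE.
rewrite mxE; congr (_ * _); rewrite /dual -mulmxA.
by rewrite /ctrmx /Amx tr_row_mx map_col_mx mul_col_mx col_mxEu.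
Qed.

(** Pairing with c is thus constant on the solutions of A u = y, which makes the lower bound on F
    independent of [x]. *)
Lemma quad_form_dual u : A *m u = y -> quad_form y B p = (ctrmx dual *m u) 0 0.
Proof. by move=> Au; rewrite ctrmx_dual -mulmxA Au. Qed.

Lemma Re_quad_form_dual :
  complex.Re (quad_form y B p) = \sum_k p 0 k * normc (dual k 0) ^+ 2.
Proof.
by rewrite (quad_form_dual mul_Amx_cdiag_dual) mulmxA Re_quad_cdiag.
Qed.

Lemma JcritE : Jcrit y B p
  = \sum_k (p 0 k * normc (dual k 0) ^+ 2 + w k * p 0 k).
Proof. by rewrite /Jcrit Re_quad_form_dual big_split. Qed.

Lemma Fcrit_xhat : nonneg_vec p -> Fcrit y B (xhat y B p) p = (Jcrit y B p)%:E.
Proof.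
move=> p0; rewrite FcritE augment_xhat JcritE -sumEFin; apply: eq_bigr => k _.
by rewrite cdiag_mulE Normc.normcM normc_real ?p0 // quad_over_lin_eq EFinD.
Qed.

Lemma Jcrit_le_Fcrit x : nonneg_vec p -> ((Jcrit y B p)%:E <= Fcrit y B x p)%E.
Proof.
(* The quadratic form q equals both Re(c^* u) and sum_k p_k |c_k|^2, so it is rewritten as 2q - q to
   match the supporting lines at slopes |c_k|. *)
move=> p0; have JE : Jcrit y B p
    = \sum_k (2 * complex.Re (Num.conj (dual k 0) * augment x k 0)
              - p 0 k * normc (dual k 0) ^+ 2 + w k * p 0 k).
  rewrite big_split /= sumrB -mulr_sumr -inner_ctrmxE.
  rewrite -(quad_form_dual (mul_Amx_augment x)) -Re_quad_form_dual /Jcrit.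
  ring.
rewrite JE FcritE -sumEFin; apply: lee_sum => k _.
apply: le_trans _ (leeD2r _ (quad_over_lin_ge _ (normc (dual k 0)) (p0 k))).
by rewrite -EFinD lee_fin !lerD2r -mulrA ler_pM2l // [leRHS]mulrC Re_conjM_le.
Qed.

End Dual.

(** Raising the powers can only lower the quotients, so only the linear penalty grows. *)
Lemma Fcrit_perturb x p e : nonneg_vec p -> 0 <= e ->
  (Fcrit y B x (p + const_mx e) <= Fcrit y B x p + (e * \sum_k w k)%:E)%E.
Proof.
move=> p0 e0; rewrite !FcritE mulr_sumr -sumEFin -big_split /=.
apply: lee_sum => k _; rewrite -addeA -EFinD !mxE.
by rewrite mulrDr [w k * e]mulrC leeD2r // quad_over_lin_le ?p0 // lerDl.
Qed.

Lemma minimizes_Jcrit_le_Fcrit phat x p :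
  minimizes (Jcrit y B) (spice_dom B) phat -> nonneg_vec p ->
  ((Jcrit y B phat)%:E <= Fcrit y B x p)%E.
Proof.
move=> [_ Jmin] p0; apply/lee_addgt0Pr => e e0.
(* The summand 1 keeps [W] positive even if all weights vanish; the shift [e / W] then costs at most
   [e]. *)
set W := 1 + \sum_k w k.
have W0 : 0 < W by rewrite ltr_pwDl // sumr_ge0 // => k _; apply: weight_ge0.
set d := e / W; have d0 : 0 < d by rewrite divr_gt0.
have q0 k : 0 < (p + const_mx d) 0 k by rewrite !mxE ltr_wpDl // p0.
have qnn : nonneg_vec (p + const_mx d) by move=> k; apply: ltW.
have qU := Rmx_unit_gt0 q0.
apply: (@le_trans _ _ (Jcrit y B (p + const_mx d))%:E).
  by rewrite lee_fin; apply: Jmin.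
apply: le_trans (Jcrit_le_Fcrit qU x qnn) _.
apply: le_trans (Fcrit_perturb _ p0 (ltW d0)) _.
rewrite leeD2l // lee_fin /d -mulrA ler_piMr ?ltW //.
by rewrite ltr_pdivrMl // mulr1 ltrDr.
Qed.

End Spice.

Theorem mainTheorem1 (R : realType) (N M : nat)
    (y : 'cV[R[i]]_N) (B : 'M[R[i]]_(N, M))
    (hB : forall k : 'I_M, col k B != 0) :
  [/\
    (* (a) *)
    forall x : 'cV[R[i]]_M,
      let pstar : 'rV[R]_(M + N) :=
        row_mx
          (\row_(k < M) (Normc.normc (x k 0)
                         / Num.sqrt (weight B (lshift N k))))
          (\row_(k < N) (Normc.normc (resid y B x k)
                         / Num.sqrt (weight B (rshift M k)))) in
      minimizes (Fcrit y B x) nonneg_vec pstar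
      /\ Fcrit y B x pstar = (2 * Lcrit y B x)%:E,
    (* (b) *)
    forall phat : 'rV[R]_(M + N),
      minimizes (Jcrit y B) (spice_dom B) phat ->
      minimizes (fun xp : 'cV[R[i]]_M * 'rV[R]_(M + N) => Fcrit y B xp.1 xp.2)
        ([set: 'cV[R[i]]_M] `*` nonneg_vec) (xhat y B phat, phat)
      /\ minimizes (Lcrit y B) [set: 'cV[R[i]]_M] (xhat y B phat)
    (* (c) *)
  & forall (xt : 'cV[R[i]]_M) (pt : 'rV[R]_(M + N)),
      minimizes (fun xp : 'cV[R[i]]_M * 'rV[R]_(M + N) => Fcrit y B xp.1 xp.2)
        ([set: 'cV[R[i]]_M] `*` nonneg_vec) (xt, pt) ->
      Rmx B pt \in unitmx ->
      minimizes (Jcrit y B) (spice_dom B) pt].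
Proof.
have w0 k : 0 < weight B k by exact: weight_gt0 (col_Amx_neq0 hB k).
split.
- move=> x pstar; have -> : pstar = lad_powers y B x.
    apply/rowP => k; rewrite -[k]splitK [RHS]mxE /pstar /augment.
    case: (split k) => j /=; first by rewrite row_mxEl col_mxEu mxE.
    by rewrite row_mxEr col_mxEd mxE /resid -row_mul !mxE.
  split; last exact: Fcrit_lad_powers.
  split=> [|p p0]; first exact: lad_powers_ge0.
  by rewrite Fcrit_lad_powers //; apply: Fcrit_ge2L.
- move=> phat Jmin; have [[p0 RU] _] := Jmin.
  have Fmin x p : nonneg_vec p ->
      (Fcrit y B (xhat y B phat) phat <= Fcrit y B x p)%E.
    by rewrite Fcrit_xhat //; apply: minimizes_Jcrit_le_Fcrit.
  split; split=> //; first by case=> x p [_ pnn]; apply: Fmin.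
  (* Chain: 2 L(xhat) <= F(xhat, phat) <= F(x, [lad_powers] of x) = 2 L(x). *)
  move=> x _; rewrite -(ler_pM2l (ltr0n _ 2)) -lee_fin -(Fcrit_lad_powers _ x) //.
  apply: le_trans (Fcrit_ge2L _ _ _ p0) _; apply: Fmin; exact: lad_powers_ge0.
- move=> xt pt [[_ pnn] Fmin] RU; split=> // p [p0 pU].
  (* Chain: J(pt) <= F(xt, pt) <= F(xhat(p), p) = J(p). *)
  rewrite -lee_fin -(Fcrit_xhat y pU p0).
  apply: le_trans (Jcrit_le_Fcrit _ RU xt pnn) _.
  by apply: (Fmin (xhat y B p, p)).
Qed.
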